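(* Let $G$ be a compact matrix Lie group, let $\mathcal{G}$ be its associated quantum group with dense $\ast$-Hopf algebra $H$, and let $\pi:P\to B$ be a classical (smooth) principal $G$-bundle with total space $P$, base space $B$ and bundle projection $\pi$. Assume that $B$ is compact. Let $\mathcal{T}$ be a complete set of mutually non-equivalent irreducible unitary $\mathcal{G}$-corepresentations containing the trivial corepresentation on $\mathbb{C}$. Then for every $\delta^V\in\mathcal{T}$ there exist $d_V\in\mathbb{N}$ and $\{T_k\}_{k=1}^{d_V}\subseteq\mathrm{Mor}(\delta^V,\Delta_P)$ such that, with $x_{ki}:=T_k(e_i)\in C^\infty_{\mathbb{C}}(P)$, where $\{e_i\}_{i=1}^{n_V}$ is the fixed orthonormal basis of $V$, $$\sum_{k=1}^{d_V}x_{ki}^\ast\,x_{kj}=\delta_{ij}\,\mathbb{1}\qquad\text{for all } i,j\in\{1,\dots,n_V\}.$$ Here $\Delta_P:C^\infty_{\mathbb{C}}(P)\to C^\infty_{\mathbb{C}}(P\times G)\cong C^\infty_{\mathbb{C}}(P)\,\otimes\,C^\infty_{\mathbb{C}}(G)$ is the pull-back of the right $G$-action on $P$, and the tensor product is the completed injective tensor product.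
   Context: $C^\infty_{\mathbb{C}}(X)$ denotes the $\ast$-algebra of complex-valued smooth functions on $X$, with $f^\ast=\overline{f}$ and unit $\mathbb{1}$ the constant function $1$. For a compact Lie group $G\subseteq M_k(\mathbb{C})$, the dense $\ast$-Hopf algebra $H\subseteq C^\infty_{\mathbb{C}}(G)$ of the associated quantum group $\mathcal{G}$ is the $\ast$-algebra generated by the matrix entry functions $w_{ij}(A)=a_{ij}$, $A=(a_{ij})\in G$, with $\Delta(g)(A,A')=g(AA')$, $\epsilon(g)=g(e)$ and $S(g)(A)=g(A^{-1})$. A $\mathcal{G}$-corepresentation on a complex vector space $V$ is a linear map $\delta^V:V\to V\otimes H$ with $(\mathrm{id}_V\otimes\epsilon)\circ\delta^V\cong\mathrm{id}_V$ and $(\mathrm{id}_V\otimes\Delta)\circ\delta^V=(\delta^V\otimes\mathrm{id}_H)\circ\delta^V$. All finite-dimensional corepresentations are taken unitary with respect to a chosen inner product on $V$; irreducible ones are finite-dimensional. For $\delta^V\in\mathcal{T}$, with $n_V=\dim_{\mathbb{C}}V$, fix an orthonormal basis $\{e_i\}_{i=1}^{n_V}$ of $V$ and write $\delta^V(e_j)=\sum_i e_i\otimes g^V_{ij}$ with $g^V_{ij}\in H$. $\mathrm{Mor}(\delta^V,\Delta_P)$ is the set of linear maps $T:V\to C^\infty_{\mathbb{C}}(P)$ with $\Delta_P\circ T=(T\otimes\mathrm{id}_H)\circ\delta^V$. Explicitly, $T(e_j)(xA)=\sum_i T(e_i)(x)\,g^V_{ij}(A)$ for all $x\in P$, $A\in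 G$. *)

(* Defs.v *)
From HB Require Import structures.
From mathcomp Require Import all_boot all_order all_algebra.
From mathcomp Require Import sesquilinear.
From mathcomp Require Import complex.
From mathcomp Require Import all_classical all_reals all_analysis.

Set Implicit Arguments.
Unset Strict Implicit.
Unset Printing Implicit Defensive.

Import Order.TTheory GRing.Theory Num.Theory.
Import numFieldNormedType.Exports.

Local Open Scope classical_set_scope.
Local Open Scope ring_scope.

(** ** Smooth manifolds *)

(* [Ck m U f] is meaningful for [U] open: [f] is [m] times continuously
   differentiable on [U]. Only the values of [f] on [U] matter. *)
Fixpoint Ck (R : realType) (V W : normedModType R) (m : nat)
    (U : set V) (f : V -> W) : Prop :=
  match m with
  | 0%N => forall x, U x -> {for x, continuous f}
  | m'.+1 => (forall x, U x -> differentiable f x) /\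
             (forall v, Ck m' U ('D_v f))
  end.

Definition smooth (R : realType) (V W : normedModType R)
    (U : set V) (f : V -> W) : Prop := forall m, Ck m U f.

(* A chart of domain [cdom]; [cmap] is only relevant on [cdom], and [cinv] on
   [cmap @` cdom]. *)
Record chart (R : realType) (M : topologicalType) (n : nat) := Chart {
  cdom : set M;
  cmap : M -> 'rV[R]_n;
  cinv : 'rV[R]_n -> M }.

Definition is_chart (R : realType) (M : topologicalType) (n : nat)
    (c : chart R M n) : Prop :=
  [/\ open (cdom c) /\ open (cmap c @` cdom c),
      forall x, cdom c x -> {for x, continuous (cmap c)},
      forall y, (cmap c @` cdom c) y -> {for y, continuous (cinv c)} &
      forall x, cdom c x -> cinv c (cmap c x) = x].

(* Atlases are not required to be maximal: any atlas determines the smooth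
   structure. *)
Record is_atlas (R : realType) (M : topologicalType) (n : nat)
    (A : set (chart R M n)) : Prop := {
  atlas_chart : forall c, A c -> is_chart c;
  atlas_cover : forall x, exists2 c, A c & cdom c x;
  atlas_compat : forall c c', A c -> A c' ->
    smooth (cmap c @` (cdom c `&` cdom c')) (cmap c' \o cinv c) }.

Record manifold (R : realType) := Manifold {
  mspace :> topologicalType;
  mdim : nat;
  matlas : set (chart R mspace mdim);
  mhausdorff : hausdorff_space mspace;
  mcountable : @second_countable mspace;
  matlasP : is_atlas matlas }.

Arguments matlas {R} m.

Definition prod_chart (R : realType) (M N : topologicalType) (m n : nat)
    (c : chart R M m) (d : chart R N n) : chart R (M * N)%type (m + n) :=
  Chart (cdom c `*` cdom d)
    (fun p => row_mx (cmap c p.1) (cmap d p.2))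
    (fun v => (cinv c (lsubmx v), cinv d (rsubmx v))).

Definition prod_atlas (R : realType) (M N : topologicalType) (m n : nat)
    (A : set (chart R M m)) (A' : set (chart R N n)) :
    set (chart R (M * N)%type (m + n)) :=
  [set e | exists c d, [/\ A c, A' d & e = prod_chart c d]].

(* Smoothness of a map between spaces with atlases, on the open set [W]. *)
Definition smooth_map (R : realType) (M N : topologicalType) (m n : nat)
    (A : set (chart R M m)) (A' : set (chart R N n))
    (W : set M) (f : M -> N) : Prop :=
  (forall x, W x -> {for x, continuous f}) /\
  (forall c d, A c -> A' d ->
     smooth (cmap c @` (cdom c `&` W `&` f @^-1` cdom d))
            (cmap d \o f \o cinv c)).

Definition smooth_vfun (R : realType) (M : topologicalType) (m : nat)
    (A : set (chart R M m)) (E : normedModType R) (f : M -> E) : Prop :=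
  forall c, A c -> smooth (cmap c @` cdom c) (f \o cinv c).

(* The elements of C^oo_C(M). *)
Definition smooth_cfun (R : realType) (M : manifold R) (f : M -> R[i]) : Prop :=
  smooth_vfun (matlas M) (fun x => complex.Re (f x) : R) /\
  smooth_vfun (matlas M) (fun x => complex.Im (f x) : R).

(** ** Matrix Lie groups *)

(* Real coordinates on M_k(C); they define both its topology and its smooth
   structure. *)
Definition realcoord (R : realType) (k : nat) (A : 'M[R[i]]_k) :
    'rV[R]_(k * k + k * k) :=
  row_mx (mxvec (map_mx (@complex.Re R) A)) (mxvec (map_mx (@complex.Im R) A)).

Definition mxset_coord (R : realType) (k : nat) (G : set 'M[R[i]]_k)
  (A : set_type G) : 'rV[R]_(k * k + k * k) := realcoord (val A).

(* [G] with the topology induced by that of M_k(C). *)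
Definition mxset_space (R : realType) (k : nat) (G : set 'M[R[i]]_k) :
  topologicalType := initial_topology (@mxset_coord R k G).

Definition mx_subgroup (R : realType) (k : nat) (G : set 'M[R[i]]_k) : Prop :=
  [/\ G 1%:M,
      forall A B, G A -> G B -> G (A *m B) &
      forall A, G A -> A \in unitmx /\ G (invmx A)].

Section MatrixGroup.
Variables (R : realType) (k : nat) (G : set 'M[R[i]]_k) (gG : mx_subgroup G).

Lemma mxset_one_subproof : 1%:M \in G.
Proof. by apply/mem_set; case: gG. Qed.

Lemma mxset_mul_subproof (A B : mxset_space G) : val A *m val B \in G.
Proof.
by apply/mem_set; case: gG => _ + _; apply; apply/set_mem/valP.
Qed.

Lemma mxset_inv_subproof (A : mxset_space G) : invmx (val A) \in G.
Proof.
apply/mem_set; case: gG => _ _ inG.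
by have /inG[] : G (val A) by apply/set_mem/valP.
Qed.

Definition mxset_one : mxset_space G := SigSub mxset_one_subproof.
Definition mxset_mul (A B : mxset_space G) : mxset_space G :=
  SigSub (mxset_mul_subproof A B).
Definition mxset_inv (A : mxset_space G) : mxset_space G :=
  SigSub (mxset_inv_subproof A).

End MatrixGroup.

(* A subgroup of GL_k(C) that is an embedded submanifold of M_k(C), with its
   group operations smooth. *)
Record matrix_lie_group (R : realType) (k : nat) := MatrixLieGroup {
  mlg_set : set 'M[R[i]]_k;
  mlg_group : mx_subgroup mlg_set;
  mlg_dim : nat;
  mlg_atlas : set (chart R (mxset_space mlg_set) mlg_dim);
  mlg_hausdorff : hausdorff_space (mxset_space mlg_set);
  mlg_countable : @second_countable (mxset_space mlg_set);
  mlg_atlasP : is_atlas mlg_atlas;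
  mlg_incl_smooth : smooth_vfun mlg_atlas (@mxset_coord R k mlg_set);
  mlg_incl_immersion : forall c, mlg_atlas c ->
    forall y, (cmap c @` cdom c) y ->
      injective ('d (@mxset_coord R k mlg_set \o cinv c) y);
  mlg_mul_smooth :
    smooth_map (prod_atlas mlg_atlas mlg_atlas) mlg_atlas [set: _]
      (fun p => mxset_mul mlg_group p.1 p.2);
  mlg_inv_smooth :
    smooth_map mlg_atlas mlg_atlas [set: _] (mxset_inv mlg_group) }.

Definition mlg_manifold (R : realType) (k : nat) (G : matrix_lie_group R k) :
    manifold R :=
  Manifold (@mlg_hausdorff R k G) (mlg_countable G) (mlg_atlasP G).
Coercion mlg_manifold : matrix_lie_group >-> manifold.

Definition mlg_val (R : realType) (k : nat) (G : matrix_lie_group R k)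
  (A : G) : 'M[R[i]]_k := \val (A : set_type (mlg_set G)).
Definition mlg_one (R : realType) (k : nat) (G : matrix_lie_group R k) : G :=
  mxset_one (mlg_group G).
Definition mlg_mul (R : realType) (k : nat) (G : matrix_lie_group R k)
  (A B : G) : G := mxset_mul (mlg_group G) A B.

(** ** Smooth principal bundles *)

Section PrincipalBundle.
Variables (R : realType) (k : nat) (G : matrix_lie_group R k).
Variables (P B : manifold R) (proj : P -> B) (act : P -> G -> P).

(* [x |-> (proj x, tau x)] is a [G]-equivariant diffeomorphism from
   [proj @^-1` U] to [U `*` G], of inverse [sigma]. *)
Definition local_trivialization (U : set B) (tau : P -> G)
    (sigma : B * G -> P) : Prop :=
  [/\ smooth_map (matlas P) (matlas G) (proj @^-1` U) tau,
      smooth_map (prod_atlas (matlas B) (matlas G))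
        (matlas P) (U `*` [set: G]) sigma,
      forall x, U (proj x) -> sigma (proj x, tau x) = x,
      forall b A, U b -> proj (sigma (b, A)) = b /\ tau (sigma (b, A)) = A &
      forall x A, U (proj x) -> tau (act x A) = mlg_mul (tau x) A].

Record principal_bundle : Prop := {
  pb_proj_smooth :
    smooth_map (matlas P) (matlas B) [set: P] proj;
  pb_act_smooth :
    smooth_map (prod_atlas (matlas P) (matlas G)) (matlas P)
      [set: P * G] (fun p => act p.1 p.2);
  pb_act1 : forall x, act x (mlg_one G) = x;
  pb_actM : forall x A A', act x (mlg_mul A A') = act (act x A) A';
  pb_proj_act : forall x A, proj (act x A) = proj x;
  pb_proj_surj : forall b, exists x, proj x = b;
  pb_loc_triv : forall b, exists U : set B, [/\ open U, U b &
    exists tau sigma, local_trivialization U tau sigma] }.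

(* The coaction [Delta_P], as the pull-back of the action. *)
Definition coaction (f : P -> R[i]) : P * G -> R[i] :=
  fun p => f (act p.1 p.2).

End PrincipalBundle.

(** ** The quantum group of G and its corepresentations *)

Section Corepresentations.
Variables (R : realType) (k : nat) (G : matrix_lie_group R k).

Inductive hopf_alg : (G -> R[i]) -> Prop :=
| hopf_entry (i j : 'I_k) : hopf_alg (fun A => mlg_val A i j)
| hopf_cst (a : R[i]) : hopf_alg (fun=> a)
| hopf_add g h : hopf_alg g -> hopf_alg h -> hopf_alg (fun A => g A + h A)
| hopf_mul g h : hopf_alg g -> hopf_alg h -> hopf_alg (fun A => g A * h A)
| hopf_star g : hopf_alg g -> hopf_alg (fun A => Num.conj (g A)).

(* An element [\sum_l v_l (x) h_l] of the algebraic tensor product of [V] and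
   [H] is represented by the function [A |-> \sum_l h_l(A) *: v_l]. *)
Definition in_tensorH (V : lmodType R[i]) (F : G -> V) : Prop :=
  exists (m : nat) (v : 'I_m -> V) (h : 'I_m -> G -> R[i]),
    (forall l, hopf_alg (h l)) /\ F = (fun A => \sum_(l < m) h l A *: v l).

(* Through the same representation (for the tensor product with two copies of
   [H], by functions on [G * G]): the maps id (x) eps, id (x) Delta,
   delta (x) id, and T (x) id. *)
Definition tensor_id_counit (V : lmodType R[i]) (F : G -> V) : V := F (mlg_one G).

Definition tensor_id_comul (V : lmodType R[i]) (F : G -> V) : G * G -> V :=
  fun p => F (mlg_mul p.1 p.2).

Definition tensor_delta_id (V : lmodType R[i]) (delta : V -> G -> V) (F : G -> V) :
  G * G -> V := fun p => delta (F p.2) p.1.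

Definition tensor_map_id (P : Type) (V : lmodType R[i]) (T : V -> P -> R[i])
  (F : G -> V) : P * G -> R[i] := fun p => T (F p.2) p.1.

(* Finite-dimensional unitary corepresentations. The forms [{dot V for _}] are
   linear in their first argument. *)
Record corep := Corep {
  cspace :> vectType R[i];
  cdot : {dot cspace for @Num.conj R[i]};
  cdelta : cspace -> G -> cspace;
  cdelta_linear : forall (a : R[i]) (u v : cspace) (A : G),
    cdelta (a *: u + v) A = a *: cdelta u A + cdelta v A;
  cdelta_tensorH : forall v, in_tensorH (cdelta v);
  cdelta_counit : forall v, tensor_id_counit (cdelta v) = v;
  cdelta_coassoc : forall v, tensor_id_comul (cdelta v) = tensor_delta_id cdelta (cdelta v);
  cdelta_unitary : forall (u v : cspace) (A : G),
    cdot (cdelta u A) (cdelta v A) = cdot u v }.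

Definition subcorep (V : corep) (W : {vspace V}) : Prop :=
  forall w, w \in W -> forall A, cdelta w A \in W.

Definition irreducible_corep (V : corep) : Prop :=
  (0 < \dim {:V})%N /\
  forall W : {vspace V}, subcorep W -> W = 0%VS \/ W = fullv.

Definition equiv_corep (V W : corep) : Prop :=
  exists2 f : {linear V -> W}, bijective f &
    forall v A, cdelta (f v) A = f (cdelta v A).

End Corepresentations.

(* The standard inner product of [C]. *)
Definition cdot1 (R : realType) (a b : R[i]^o) : R[i] := a * Num.conj b.

Section TrivialCorep.
Variables (R : realType).

Lemma cdot1_bilinear :
  bilinear_for *%R (Num.conj \; *%R) (@cdot1 R).
Proof.
split=> [b | a] c u v; rewrite /cdot1 /=.
  by rewrite mulrDl -mulrA.
by rewrite rmorphD rmorphM mulrDr mulrCA.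
Qed.

HB.instance Definition _ := bilinear_isBilinear.Build R[i] R[i]^o R[i]^o R[i]
  _ _ (@cdot1 R) cdot1_bilinear.

Lemma cdot1_hermitian (a b : R[i]^o) :
  cdot1 a b = (-1) ^+ false * Num.conj (cdot1 b a).
Proof. by rewrite /cdot1 expr0 mul1r rmorphM /= conjCK mulrC. Qed.

HB.instance Definition _ := isHermitianSesquilinear.Build R[i] R[i]^o
  false (@Num.conj R[i]) (@cdot1 R) cdot1_hermitian.

Lemma cdot1_gt0 (a : R[i]^o) : a != 0 -> 0 < cdot1 a a.
Proof. by move=> a0; rewrite /cdot1 mul_conjC_gt0. Qed.

HB.instance Definition _ := isDotProduct.Build R[i] R[i]^o (@cdot1 R) cdot1_gt0.

Variables (k : nat) (G : matrix_lie_group R k).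

Definition triv_delta (a : R[i]^o) (_ : G) : R[i]^o := a.

Lemma triv_linear (a : R[i]) (u v : R[i]^o) (A : G) :
  triv_delta (a *: u + v) A = a *: triv_delta u A + triv_delta v A.
Proof. by []. Qed.

Lemma triv_tensorH (v : R[i]^o) : in_tensorH (triv_delta v).
Proof.
exists 1%N, (fun=> v), (fun _ _ => 1); split; first by move=> _; apply: hopf_cst.
by apply/funext => A; rewrite big_ord1 scale1r.
Qed.

Definition triv_corep : corep G :=
  @Corep R k G R[i]^o (@cdot1 R) triv_delta triv_linear
    triv_tensorH (fun=> erefl) (fun=> erefl) (fun _ _ _ => erefl).

End TrivialCorep.

Definition complete_irreducibles (R : realType) (k : nat)
    (G : matrix_lie_group R k) (T : corep G -> Prop) : Prop :=
  [/\ forall V, T V -> irreducible_corep V,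
      forall V W, T V -> T W -> equiv_corep V W -> V = W,
      forall V, irreducible_corep V -> exists2 W, T W & equiv_corep V W &
      T (triv_corep G)].

(** ** Intertwiners with the coaction on C^oo_C(P) *)

Definition Mor (R : realType) (k : nat) (G : matrix_lie_group R k)
    (P : manifold R) (act : P -> G -> P) (V : corep G) :
    set (V -> P -> R[i]) :=
  [set T | [/\ forall (a : R[i]) (u v : V) (x : P),
                 T (a *: u + v) x = a * T u x + T v x,
               forall v, smooth_cfun (T v) &
               forall v, coaction act (T v) = tensor_map_id T (cdelta v)]].

Arguments Mor {R k G P} act V.

(* Main.v *)
From HB Require Import structures.
Require Import Defs.
From mathcomp Require Import all_boot all_order all_algebra.
From mathcomp Require Import sesquilinear.
From mathcomp Require Import complex.
From mathcomp Require Import ring lra.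
From mathcomp Require Import all_classical all_reals all_analysis.

Import Order.TTheory GRing.Theory Num.Theory.
Import numFieldNormedType.Exports.

Local Open Scope classical_set_scope.
Local Open Scope ring_scope.

(** Over an open set of [B] on which the bundle is trivial, the group coordinate
    [tau : P -> G] of a trivialization satisfies [tau (x A) = tau x A].  Since
    the coefficients [g] of a corepresentation are multiplicative,
    [g_rj (tau (x A)) = sum_i g_ri (tau x) g_ij (A)]: for each row [r], the
    assignment [e_j |-> g_rj o tau] is an intertwiner defined over that open
    set.  The matrix [g (tau x)] is unitary, so
    [sum_r conj (g_ri (tau x)) g_rj (tau x) = delta_ij].

    It remains to glue.  As [B] is compact, there are finitely many smooth
    functions [phi_l] on [B], each supported in a trivializing open set, with
    [sum_l phi_l ^ 2 = 1] ([square_partition]).  The functions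
    [(phi_l o pi) * (g_rj o tau_l)] are defined and smooth on all of [P]
    ([smooth_on_cutoff]), remain equivariant because [pi] is invariant, and are
    indexed by the pairs [(l, r)]; the sum over these pairs of
    [conj x_i * x_j] is [sum_l phi_l ^ 2 delta_ij = delta_ij].

    The analytic input is the existence of the [phi_l].  It is obtained from the
    function [exp (-1/x)] ([smooth_flat]) composed with charts
    ([bump_function]), normalized by a power of a positive smooth function
    ([smooth_powR]), and it rests on the chain rule for functions of class C^m
    ([Ck_comp_frame]). *)

Set Implicit Arguments.
Unset Strict Implicit.
Unset Printing Implicit Defensive.

(** * Calculus of C^m functions on normed spaces *)

(** Differentiability is a statement about a germ: the difference [g - f]
    vanishes near [a], so it has differential 0 there. *)
Lemma near_eq_differentiable (R : realType) (V W : normedModType R)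
    (f g : V -> W) (a : V) :
  (\near a, f a = g a) -> differentiable f a -> differentiable g a.
Proof.
move=> fg df.
have z0 (k : V -> W) : (\near a, k a = 0) -> differentiable k a.
  move=> ka0.
  have ko : k \o shift a = cst (k a) + (\0 : V -> W) +o_ 0 id.
    apply/eqaddoP => _/posnumP[e].
    have : \forall x \near (0 : V), k (x + a) = 0.
      move: ka0; rewrite [X in X -> _](near_shift 0).
      apply: filterS => x /=; by rewrite subr0.
    apply: filterS => x kx; rewrite /= /cst.
    rewrite -![(_ + _ : _ -> _) _]/(_ + _) -![(- _ : _ -> _) _]/(- _) /=.
    rewrite kx -![(_ + _ : _ -> _) _]/(_ + _) /= (nbhs_singleton ka0).
    rewrite addr0 subr0.
    by rewrite normr0 mulr_ge0.
  have dk := diff_unique (df := (\0 : {linear V -> W}))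
    (@cst_continuous _ _ 0) ko.
  by apply/diff_locallyP; rewrite dk; split => //; exact: cst_continuous.
have -> : g = f + (g - f) by rewrite addrC subrK.
apply: differentiableD => //; apply: z0; apply: filterS fg => x fgx.
by rewrite -[LHS]/(g x - f x) fgx subrr.
Qed.

Section SmoothCalculus.
Variable R : realType.
Implicit Types (V W : normedModType R) (m : nat).

Lemma Ck_subset V W m (U O : set V) (f : V -> W) :
  O `<=` U -> Ck m U f -> Ck m O f.
Proof.
move=> OU; elim: m f => [|m IH] f /=; first by move=> fc x /OU/fc.
by move=> [fd fC]; split=> [x /OU/fd//|v]; apply: IH.
Qed.

(** [Ck] is a condition at each point of its set separately, so the sets [D] may
    be arbitrary. *)
Lemma Ck_local V W m (U : set V) (f : V -> W) :
  (forall x, U x -> exists2 D : set V, D x & Ck m D f) -> Ck m U f.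
Proof.
elim: m f => [|m IH] f H; first by move=> x /H[D Dx]; apply.
split=> [x /H[D Dx [fd _]]|v]; first exact: (fd x Dx).
by apply: IH => x /H[D Dx [_ fC]]; exists D; last exact: (fC v).
Qed.

Lemma open_near V (U : set V) x (P : V -> Prop) :
  open U -> U x -> (forall y, U y -> P y) -> \near x, P x.
Proof. by move=> oU Ux UP; apply: filterS (open_nbhs_nbhs (conj oU Ux)). Qed.

(** Openness makes [f] and [g] equal near each point of [U], so that their
    iterated directional derivatives also agree on [U]. *)
Lemma eq_Ck V W m (U : set V) (f g : V -> W) :
  open U -> (forall x, U x -> f x = g x) -> Ck m U f -> Ck m U g.
Proof.
move=> oU; elim: m f g => [|m IH] f g fg /=.
  move=> fc x Ux.
  rewrite /prop_for /continuous_at -fg //.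
  apply: cvg_trans (fc x Ux); apply: near_eq_cvg.
  exact: open_near oU Ux fg.
move=> [fd fC]; split=> [x Ux|v].
  by apply: near_eq_differentiable (fd x Ux); apply: open_near oU Ux fg.
apply: IH (fC v) => x Ux; apply: near_eq_derive.
exact: open_near oU Ux fg.
Qed.

Lemma CkS V W m (U : set V) (f : V -> W) : Ck m.+1 U f -> Ck m U f.
Proof.
elim: m f => [|m IH] f [fd fC].
  by move=> x /fd; apply: differentiable_continuous.
by split=> // v; apply: IH.
Qed.

Lemma Ck_cst V W m (U : set V) (a : W) : Ck m U (fun=> a).
Proof.
elim: m a => [|m IH] a; first by move=> x _; apply: cst_continuous.
split=> [x _|v]; first exact: differentiable_cst.
suff -> : 'D_v (fun=> a) = (fun=> 0) :> (V -> W) by apply: IH.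
by apply/funext => x; rewrite derive_cst.
Qed.

Lemma Ck_add V W m (U : set V) (f g : V -> W) : open U ->
  Ck m U f -> Ck m U g -> Ck m U (fun x => f x + g x).
Proof.
move=> oU; elim: m f g => [|m IH] f g.
  by move=> fc gc x Ux; apply: continuousD; [apply: fc|apply: gc].
move=> [fd fC] [gd gC]; split=> [x Ux|v].
  by apply: differentiableD; [apply: fd|apply: gd].
apply: eq_Ck (IH _ _ (fC v) (gC v)) => // x Ux.
by rewrite deriveD //; apply: diff_derivable; [apply: fd|apply: gd].
Qed.

Lemma Ck_mul V m (U : set V) (f g : V -> R) : open U ->
  Ck m U f -> Ck m U g -> Ck m U (fun x => f x * g x).
Proof.
move=> oU; elim: m f g => [|m IH] f g.
  by move=> fc gc x Ux; apply: continuousM; [apply: fc|apply: gc].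
move=> fC1 gC1; have [fd fC] := fC1; have [gd gC] := gC1.
split=> [x Ux|v].
  by apply: differentiableM; [apply: fd|apply: gd].
have fg := IH _ _ (CkS fC1) (gC v); have gf := IH _ _ (CkS gC1) (fC v).
apply: eq_Ck (Ck_add oU fg gf) => // x Ux.
by rewrite deriveM //; apply: diff_derivable; [apply: fd|apply: gd].
Qed.

Lemma Ck_sum V m (U : set V) (I : Type) (r : seq I) (f : I -> V -> R) :
  open U ->
  (forall i, Ck m U (f i)) -> Ck m U (fun x => \sum_(i <- r) f i x).
Proof.
move=> oU fC; elim: r => [|i r IH].
  by under eq_fun do rewrite big_nil; apply: Ck_cst.
by under eq_fun do rewrite big_cons; apply: Ck_add.
Qed.

Lemma Ck_linear_comp V W m (U : set V) (l : {linear W -> R}) (f : V -> W) :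
  continuous l -> open U -> Ck m U f -> Ck m U (l \o f).
Proof.
move=> lc oU; elim: m f => [|m IH] f.
  by move=> fc x Ux; apply: continuous_comp; [apply: fc|apply: lc].
move=> [fd fC]; split=> [x Ux|v].
  by apply: differentiable_comp; [apply: fd|apply: linear_differentiable].
apply: eq_Ck (IH _ (fC v)) => // x Ux /=.
have ld : differentiable l (f x) by apply: linear_differentiable.
have dfx := fd x Ux.
have dlf : differentiable (l \o f) x by apply: differentiable_comp.
rewrite (deriveE v dfx) (deriveE v dlf) (diff_comp dfx ld) /=.
by rewrite (diff_lin _ lc).
Qed.

(** The chain rule, by induction on [m]: in a target space with a finite frame
    [b] and continuous dual coordinates [l],
    [D_v (g o f) = sum_i (D_(b i) g o f) * l_i (D_v f)],
    whose factors are one degree less regular.  The frame covers both row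
    vectors and scalars. *)
Lemma Ck_comp_frame V W m n (U : set V) (O : set W) (g : W -> R) (f : V -> W)
    (b : 'I_n -> W) (l : 'I_n -> {linear W -> R}) :
  (forall i, continuous (l i)) -> (forall w, w = \sum_(i < n) l i w *: b i) ->
  open U -> (forall x, U x -> O (f x)) ->
  Ck m O g -> Ck m U f -> Ck m U (g \o f).
Proof.
move=> lc lb oU UO; elim: m g => [|m IH] g.
  move=> gc fc x Ux.
  by apply: continuous_comp; [apply: fc|apply: gc; apply: UO].
move=> [gd gC] fC1; have [fd fC] := fC1; split=> [x Ux|v].
  by apply: differentiable_comp; [apply: fd|apply: gd; apply: UO].
apply: (eq_Ck (f := fun x =>
  \sum_(i < n) 'D_(b i) g (f x) * l i ('D_v f x))) => //.
  move=> x Ux; have dfx := fd x Ux; have dgx := gd _ (UO x Ux).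
  have dgfx : differentiable (g \o f) x by apply: differentiable_comp.
  rewrite (deriveE _ dgfx) (diff_comp dfx dgx) /= -(deriveE v dfx).
  rewrite [in RHS](lb ('D_v f x)) linear_sum /=; apply: eq_bigr => i _.
  by rewrite linearZ /= (deriveE _ dgx) mulrC.
apply: Ck_sum => // i; apply: Ck_mul => //.
  by apply: (IH ('D_(b i) g)); [exact: gC|exact: CkS fC1].
exact: (Ck_linear_comp (lc i) oU (fC v)).
Qed.

Definition row_coord n (i : 'I_n) (v : 'rV[R]_n) : R := v ord0 i.

Lemma row_coord_is_linear n (i : 'I_n) : linear (@row_coord n i).
Proof. by move=> a u v; rewrite /row_coord !mxE. Qed.

HB.instance Definition _ n (i : 'I_n) :=
  GRing.isLinear.Build R 'rV[R]_n R _ (@row_coord n i)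
    (@row_coord_is_linear n i).

Lemma Ck_comp V m n (U : set V) (O : set 'rV[R]_n) (g : 'rV[R]_n -> R)
    (f : V -> 'rV[R]_n) :
  open U -> (forall x, U x -> O (f x)) ->
  Ck m O g -> Ck m U f -> Ck m U (g \o f).
Proof.
apply: (Ck_comp_frame (b := fun i => delta_mx ord0 i)
  (l := fun i => @row_coord n i)).
  by move=> i; apply: coord_continuous.
by move=> w; rewrite [LHS]row_sum_delta.
Qed.

Lemma Ck_comp1 V m (U : set V) (O : set R) (g : R -> R) (f : V -> R) :
  open U -> (forall x, U x -> O (f x)) ->
  Ck m O g -> Ck m U f -> Ck m U (g \o f).
Proof.
apply: (Ck_comp_frame (b := fun=> 1 : R) (l := fun _ : 'I_1 => idfun)) => //.
  by move=> i x.
by move=> w; rewrite big_ord1 /= [RHS]mulr1.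
Qed.

Lemma Ck_coord V m n (U : set V) (f : V -> 'rV[R]_n) (i : 'I_n) :
  open U -> Ck m U f -> Ck m U (fun x => f x ord0 i).
Proof.
by apply: (Ck_linear_comp (l := @row_coord n i)); apply: coord_continuous.
Qed.
End SmoothCalculus.

(** * Two smooth functions of one variable *)

Section OneVariable.
Variable R : realType.
Implicit Types (m n : nat) (x : R).

(** On the line, [D_v f = v f'], so one derivative decides regularity. *)
Lemma Ck_is_derive m (U : set R) (f f' : R -> R) : open U ->
  (forall x, U x -> is_derive x 1 f (f' x)) -> Ck m U f' -> Ck m.+1 U f.
Proof.
move=> oU ff' f'C.
have fd x : U x -> differentiable f x.
  by move=> Ux; have [/derivable1_diffP] := ff' x Ux.
split=> // v; apply: eq_Ck (Ck_mul oU (Ck_cst m U (v : R)) f'C) => // x Ux.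
have [_ <-] := ff' x Ux.
rewrite !deriveE; [|exact: fd|exact: fd].
have -> : v = (v : R) *: (1 : R) by rewrite [RHS]mulr1.
by rewrite linearZ [in LHS]/GRing.scale /= mulr1.
Qed.

(** [flat 0] is the classical function [exp (-1/x)], flat at the origin.  The
    extra factor [x^-n] gives a family closed under differentiation, up to
    linear combinations, which turns smoothness into an induction. *)
Definition flat n x : R := if 0 < x then x^-1 ^+ n * expR (- x^-1) else 0.

Lemma flat_ge0 n x : 0 <= flat n x.
Proof.
rewrite /flat; case: ifPn => // x0.
by rewrite mulr_ge0 ?expR_ge0 // exprn_ge0 // invr_ge0 ltW.
Qed.

Lemma flat_gt0 n x : 0 < x -> 0 < flat n x.
Proof.
by move=> x0; rewrite /flat x0 mulr_gt0 ?expR_gt0 // exprn_gt0 ?invr_gt0.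
Qed.

Lemma flat_le0 n x : x <= 0 -> flat n x = 0.
Proof. by move=> x0; rewrite /flat ltNge x0. Qed.

(** [flat n.+1] is the difference quotient of [flat n] at the origin. *)
Lemma flatS n x : flat n.+1 x * x = flat n x.
Proof.
rewrite /flat; case: ifPn => [x0|]; last by rewrite mul0r.
by rewrite exprS mulrC !mulrA divff ?mul1r // gt_eqF.
Qed.

(** With [y = 1/x], this is the bound [y ^ (n+1) / (n+1)! <= exp y] given by the
    power series of the exponential. *)
Lemma flat_le n x : 0 < x -> flat n x <= n.+1`!%:R * x.
Proof.
move=> x0; rewrite /flat x0 expRN ler_pdivrMr ?expR_gt0 //.
have y0 : 0 <= x^-1 by rewrite invr_ge0 ltW.
apply: (@le_trans _ _ (n.+1`!%:R * x * (x^-1 ^+ n.+1 / n.+1`!%:R))).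
  have f0 : n.+1`!%:R != 0 :> R by rewrite pnatr_eq0 -lt0n fact_gt0.
  rewrite le_eqVlt; apply/orP; left; apply/eqP.
  by rewrite exprS; field; rewrite f0 gt_eqF.
rewrite ler_pM2l; last by rewrite mulr_gt0 // ltr0n fact_gt0.
by apply: le_trans (expR_ge1Dxn n y0); rewrite lerDr.
Qed.

Lemma flat_continuous0 n : {for 0, continuous (flat n)}.
Proof.
rewrite /prop_for /continuous_at (flat_le0 _ (lexx 0)).
apply/cvgr0Pnorm_le => e e0.
have d0 : 0 < e / n.+1`!%:R by rewrite divr_gt0 // ltr0n fact_gt0.
apply: filterS (nbhs0_ltW d0) => x xd.
rewrite ger0_norm ?flat_ge0 //.
have [x0|x0] := leP x 0; first by rewrite flat_le0 // ltW.
apply: le_trans (flat_le n x0) _.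
by rewrite mulrC -ler_pdivlMr // ltr0n fact_gt0.
Qed.

(** Away from 0 this is a computation.  At 0, Caratheodory's criterion applies:
    the difference quotient is [flat n.+1], which is continuous there. *)
Lemma is_derive_flat n x :
  is_derive x 1 (flat n) (flat n.+2 x - n%:R * flat n.+1 x).
Proof.
have [x0|x0|->] := ltgtP x 0.
- rewrite !flat_le0 ?ltW // mulr0 subr0.
  apply: (@near_eq_is_derive _ _ _ (cst (0 : R))).
  by apply: filterS (lt_nbhsl x0) => y y0; rewrite flat_le0 // ltW.
- pose h : R -> R := (id ^+ n) * (expR \o -%R).
  have hE y : h y = y ^+ n * expR (- y).
    by rewrite /h -[LHS]/((id ^+ n) y * expR (- y)) exprfctE.
  have dh : is_derive x^-1 1 h (n%:R * x^-1 ^+ n.-1 * expR (- x^-1) - h x^-1).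
    rewrite hE; apply: is_derive_eq.
    by rewrite exprfctE /GRing.scale /=; ring.
  have dV : is_derive x 1 (fun y : R => y^-1) (- x ^- 2).
    have := is_deriveV (f := id) (lt0r_neq0 x0) (is_derive_id x (1 : R)).
    by rewrite /= [X in is_derive _ _ _ X]mulr1.
  have dhV := is_derive1_comp dh dV.
  have hflat : \near x, (h \o (fun y => y^-1)) x = flat n x.
    by apply: filterS (lt_nbhsr x0) => y y0; rewrite /flat y0 /= hE.
  apply: is_derive_eq (near_eq_is_derive hflat dhV) _.
  rewrite /flat x0 hE.
  case: n {h hE dh dhV hflat} => [|n] /=; rewrite !exprS; field;
    by rewrite gt_eqF.
- rewrite !flat_le0 // mulr0 subr0; apply/is_derive1_caratheodory.
  exists (flat n.+1); split; last by rewrite flat_le0.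
    by move=> z; rewrite (flat_le0 n (lexx 0)) !subr0 flatS.
  exact: flat_continuous0.
Qed.

Lemma smooth_flat n : smooth setT (flat n).
Proof.
move=> m; elim: m n => [|m IH] n.
  move=> x _; apply/differentiable_continuous/derivable1_diffP.
  by have [] := is_derive_flat n x.
apply: (Ck_is_derive openT (fun x _ => is_derive_flat n x)).
apply: (Ck_add openT (IH _)).
apply: (eq_Ck openT _ (Ck_mul openT (Ck_cst m setT (- n%:R : R)) (IH n.+1))).
by move=> x _; rewrite mulNr.
Qed.

Lemma smooth_powR (a : R) : smooth [set x : R | 0 < x] (fun x => x `^ a).
Proof.
have oR : open [set x : R | 0 < x] by exact: open_gt.
have d (b x : R) : 0 < x -> is_derive x 1 (fun x => x `^ b) (b * x `^ (b - 1)).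
  by move=> x0; apply: is_derive1_powR.
move=> m; elim: m a => [|m IH] a.
  move=> x x0; apply/differentiable_continuous/derivable1_diffP.
  by have [] := d a x x0.
apply: (Ck_is_derive oR (d a)).
exact: (Ck_mul oR (Ck_cst m _ (a : R)) (IH _)).
Qed.

End OneVariable.

(** * Smooth functions on open subsets of a manifold *)

Section SmoothFunctions.
Variable R : realType.

Definition smooth_on (M : topologicalType) n (A : set (chart R M n))
    (W : set M) (f : M -> R) : Prop :=
  forall c, A c -> smooth (cmap c @` (cdom c `&` W)) (f \o cinv c).

Lemma smooth_onT (M : topologicalType) n (A : set (chart R M n)) (f : M -> R) :
  smooth_on A setT f <-> smooth_vfun A f.
Proof. by split=> sf c Ac; have := sf c Ac; rewrite setIT. Qed.

Lemma chart_image_open (M : topologicalType) n (c : chart R M n) (W : set M) :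
  is_chart c -> open W -> open (cmap c @` (cdom c `&` W)).
Proof.
move=> [[oc oi] _ ci cK] oW; rewrite openE => _ [x [cx Wx] <-].
have yi : (cmap c @` cdom c) (cmap c x) by exists x.
have : nbhs (cinv c (cmap c x)) W by rewrite cK //; apply: open_nbhs_nbhs.
move=> /(ci _ yi) nW; apply: filterS2 (open_nbhs_nbhs (conj oi yi)) nW.
move=> _ [x' cx' <-]; rewrite /= cK // => Wx'; by exists x'.
Qed.

Lemma image_cinvP (M : topologicalType) n (c : chart R M n) (W : set M) y :
  is_chart c -> (cmap c @` (cdom c `&` W)) y ->
  cdom c (cinv c y) /\ W (cinv c y).
Proof. by move=> [_ _ _ cK] [x [cx Wx] <-]; rewrite cK. Qed.

Section OneManifold.
Variables (M : topologicalType) (n : nat) (A : set (chart R M n)).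
Hypothesis aA : is_atlas A.
Implicit Types (W O : set M) (f g : M -> R).

Let image_open c W : A c -> open W -> open (cmap c @` (cdom c `&` W)).
Proof. by move=> /(atlas_chart aA); apply: chart_image_open. Qed.

Lemma smooth_on_subset W O f : O `<=` W -> smooth_on A W f -> smooth_on A O f.
Proof.
move=> OW sf c Ac m; apply: Ck_subset (sf c Ac m) => _ [x [cx Ox] <-].
by exists x => //; split => //; apply: OW.
Qed.

Lemma eq_smooth_on W f g :
  open W -> (forall x, W x -> f x = g x) -> smooth_on A W f -> smooth_on A W g.
Proof.
move=> oW fg sf c Ac m; apply: eq_Ck (sf c Ac m); first exact: image_open.
by move=> y /(image_cinvP (atlas_chart aA Ac))[_ Wy] /=; apply: fg.
Qed.

Lemma smooth_on_local W f :
  (forall x, W x -> exists O, [/\ open O, O x & smooth_on A O f]) ->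
  smooth_on A W f.
Proof.
move=> H c Ac m; apply: Ck_local => _ [x [cx Wx] <-].
have [D [oD Dx sD]] := H x Wx.
by exists (cmap c @` (cdom c `&` D)); [exists x|exact: sD].
Qed.

Lemma smooth_on_cst W (a : R) : smooth_on A W (fun=> a).
Proof. by move=> c Ac m; apply: Ck_cst. Qed.

Lemma smooth_onD W f g : open W ->
  smooth_on A W f -> smooth_on A W g -> smooth_on A W (fun x => f x + g x).
Proof.
move=> oW sf sg c Ac m.
by apply: (Ck_add (image_open Ac oW) (sf c Ac m) (sg c Ac m)).
Qed.

Lemma smooth_onM W f g : open W ->
  smooth_on A W f -> smooth_on A W g -> smooth_on A W (fun x => f x * g x).
Proof.
move=> oW sf sg c Ac m.
by apply: (Ck_mul (image_open Ac oW) (sf c Ac m) (sg c Ac m)).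
Qed.

Lemma smooth_on_sum W (I : Type) (r : seq I) (f : I -> M -> R) : open W ->
  (forall i, smooth_on A W (f i)) ->
  smooth_on A W (fun x => \sum_(i <- r) f i x).
Proof.
move=> oW sf; elim: r => [|i r IH].
  by under eq_fun do rewrite big_nil; apply: smooth_on_cst.
by under eq_fun do rewrite big_cons; apply: smooth_onD.
Qed.

Lemma smooth_on_comp1 W (D : set R) (g : R -> R) f : open W ->
  (forall x, W x -> D (f x)) -> smooth D g -> smooth_on A W f ->
  smooth_on A W (g \o f).
Proof.
move=> oW WD sg sf c Ac m.
apply: (Ck_comp1 (image_open Ac oW) _ (sg m) (sf c Ac m)).
by move=> y /(image_cinvP (atlas_chart aA Ac))[_ Wy] /=; apply: WD.
Qed.

(** Transition maps between charts are smooth, so a smooth function of the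
    coordinates of one chart is smooth on its domain. *)
Lemma smooth_on_chart c (g : 'rV[R]_n -> R) :
  A c -> smooth setT g -> smooth_on A (cdom c) (g \o cmap c).
Proof.
move=> Ac sg c' Ac' m.
have [[oc _] _ _ _] := atlas_chart aA Ac.
exact: (Ck_comp (image_open Ac' oc) (fun _ _ => I) (sg m)
  (atlas_compat aA Ac' Ac m)).
Qed.

Lemma smooth_on_continuous f : smooth_on A setT f -> continuous f.
Proof.
move=> sf x; have [c Ac cx] := atlas_cover aA x.
have [[oc _] cc _ cK] := atlas_chart aA Ac.
have fc : {for cmap c x, continuous (f \o cinv c)}.
  by apply: (sf c Ac 0%N); exists x.
have : {for x, continuous ((f \o cinv c) \o cmap c)}.
  by apply: continuous_comp => //; apply: cc.
rewrite /prop_for /continuous_at /= cK //; apply: cvg_trans; apply: near_eq_cvg.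
by apply: filterS (open_nbhs_nbhs (conj oc cx)) => y cy; rewrite /= cK.
Qed.

(** A function [g] that is smooth only on [W] becomes globally smooth after
    multiplication by a function supported in a closed subset of [W]: the
    product is zero on the open complement of the support. *)
Lemma smooth_on_cutoff W C f g : open W -> closed C -> C `<=` W ->
  (forall x, ~ C x -> f x = 0) ->
  smooth_on A setT f -> smooth_on A W g ->
  smooth_on A setT (fun x => f x * g x).
Proof.
move=> oW cC CW f0 sf sg; apply: smooth_on_local => x _.
have [Cx|nCx] := pselect (C x).
  exists W; split => //; first exact: CW.
  by apply: smooth_onM => //; apply: smooth_on_subset sf.
exists (~` C); split => //; first exact: closed_openC.
apply: (eq_smooth_on _ (f := fun=> 0)); first exact: closed_openC.
  by move=> y /f0 ->; rewrite mul0r.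
exact: smooth_on_cst.
Qed.

(** Near a point, [g o F] reads in charts as
    [(g o d^-1) o (d o F o c^-1)], a composite of smooth maps between
    coordinate spaces. *)
Lemma smooth_on_pullback (N : topologicalType) p (A' : set (chart R N p))
    W (F : M -> N) (g : N -> R) :
  is_atlas A' -> open W -> smooth_map A A' W F -> smooth_on A' setT g ->
  smooth_on A W (g \o F).
Proof.
move=> aA' oW [Fc Fs] sg c Ac m; apply: Ck_local => _ [x [cx Wx] <-].
have [d Ad dx] := atlas_cover aA' (F x).
have [[od _] _ _ dK] := atlas_chart aA' Ad.
pose D := cdom c `&` W `&` F @^-1` cdom d.
have oD : open D.
  have [[oc _] _ _ _] := atlas_chart aA Ac.
  rewrite openE => z [[cz Wz] dz].
  have nd := Fc z Wz _ (open_nbhs_nbhs (conj od dz)).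
  apply: filterS3 (open_nbhs_nbhs (conj oc cz))
    (open_nbhs_nbhs (conj oW Wz)) nd.
  by [].
have DE : cmap c @` (cdom c `&` D) = cmap c @` D.
  by rewrite /D !setIA setIid.
have oD' : open (cmap c @` D) by rewrite -DE; apply: image_open.
exists (cmap c @` D); first by exists x.
have sgd : Ck m (cmap d @` cdom d) (g \o cinv d).
  by have := sg d Ad m; rewrite setIT.
have K := Ck_comp oD' _ sgd (Fs c d Ac Ad m).
have cK : is_chart c := atlas_chart aA Ac.
have H y : (cmap c @` D) y -> cdom d (F (cinv c y)).
  by rewrite -DE => /(image_cinvP cK)[_ []].
apply: (eq_Ck oD' _ (K _)) => y /H Hy /=; first by rewrite dK.
by exists (F (cinv c y)).
Qed.

End OneManifold.

(** * Bump functions and partitions of unity *)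

Lemma Ck_id (V : normedModType R) m (U : set V) : Ck m U (@id V).
Proof.
case: m => [|m]; first by move=> x _; apply: cvg_id.
split=> [x _|v]; first exact: (@ex_diff _ _ _ _ _ _ _ (is_diff_id x)).
suff -> : 'D_v id = (fun=> v) :> (V -> V) by apply: Ck_cst.
by apply/funext => x; rewrite derive_id.
Qed.

Definition sqdist n (a y : 'rV[R]_n) : R :=
  \sum_(i < n) (y ord0 i - a ord0 i) ^+ 2.

Lemma smooth_sqdist n (a : 'rV[R]_n) : smooth setT (sqdist a).
Proof.
move=> m; rewrite /sqdist; apply: Ck_sum openT _ => i.
have C : Ck m setT (fun y : 'rV[R]_n => y ord0 i - a ord0 i).
  apply: (Ck_add openT _ (Ck_cst m setT (- a ord0 i))).
  by apply: (Ck_coord i openT); apply: Ck_id.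
exact: (Ck_mul openT C C).
Qed.

(** The bump is [exp (-1 / (e^2 - |y - a|^2))] in the coordinates [y] of a
    chart, [a] being those of [b], extended by zero.  The compact box [K] around
    [a] contains its support; the inverse chart carries [K] to a compact set,
    which is closed because the manifold is Hausdorff, and this is what makes
    the extension by zero smooth. *)
Lemma bump_function (B : manifold R) (U : set B) (b : B) : open U -> U b ->
  exists h : B -> R, [/\ smooth_on (matlas B) setT h, 0 < h b &
    exists C, [/\ closed C, C `<=` U & forall x, ~ C x -> h x = 0]].
Proof.
move=> oU Ub; have aB := matlasP B.
have [c Ac cb] := atlas_cover aB b.
have cc := atlas_chart aB Ac; have [[oc oi] cmc cic cK] := cc.
pose a := cmap c b.
have oi' := chart_image_open cc oU.
have ai : (cmap c @` (cdom c `&` U)) a by exists b.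
have /nbhs_ballP[_ /posnumP[r] rU] := open_nbhs_nbhs (conj oi' ai).
pose e : R := r%:num / 2.
have r0 : 0 < r%:num :> R by [].
have e0 : 0 < e by rewrite divr_gt0.
pose K := [set y : 'rV[R]_(mdim B) | forall i,
  [set` `[a ord0 i - e, a ord0 i + e]] (y ord0 i)].
have KU : K `<=` cmap c @` (cdom c `&` U).
  move=> y Ky; apply: rU; split=> // i j; rewrite ord1.
  have := Ky j; rewrite /= in_itv /= => /andP[ly uy].
  rewrite /ball /= ltr_norml; apply/andP; rewrite /e in ly uy; split; lra.
have cK' : compact K := @rV_compact R (mdim B) _
  (fun i => @segment_compact R (a ord0 i - e) (a ord0 i + e)).
pose C := cinv c @` K.
have clC : closed C.
  apply: compact_closed; first exact: mhausdorff.
  apply: continuous_compact => //.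
  apply: continuous_in_subspaceT => y /set_mem /KU [x [cx _] <-].
  by apply: cic; exists x.
have CU : C `<=` cdom c `&` U by move=> _ [y /KU [x [cx Ux] <-] <-]; rewrite cK.
pose g y := flat 0 (e ^+ 2 - sqdist a y).
have gK y : ~ K y -> g y = 0.
  move=> nK; apply: flat_le0; rewrite leNgt subr_gt0; apply/negP => qe.
  apply: nK => i /=; rewrite in_itv /= -ler_distl.
  rewrite -ler_sqr ?nnegrE ?normr_ge0 ?(ltW e0) // real_normK ?num_real //.
  apply: le_trans (ltW qe); rewrite /sqdist (bigD1 i) //= lerDl.
  by apply: sumr_ge0 => j _; apply: sqr_ge0.
pose h x := if `[< cdom c x >] then g (cmap c x) else 0.
have hC x : ~ C x -> h x = 0.
  move=> nC; rewrite /h; case: asboolP => // cx; apply: gK => Kx.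
  by apply: nC; exists (cmap c x) => //; rewrite cK.
exists h; split.
- apply: smooth_on_local => x _; have [Cx|nCx] := pselect (C x).
    exists (cdom c); split => //; first by have [] := CU _ Cx.
    apply: (eq_smooth_on aB oc (f := g \o cmap c)) => [y cy|].
      by rewrite /h; case: asboolP.
    apply: (smooth_on_chart aB Ac) => m.
    have qC : Ck m setT (fun y => e ^+ 2 - sqdist a y).
      apply: (Ck_add openT (Ck_cst m setT (e ^+ 2))).
      apply: (eq_Ck openT _
        (Ck_mul openT (Ck_cst m setT (-1 : R)) (smooth_sqdist a m))).
      by move=> y _; rewrite mulN1r.
    exact: (@Ck_comp1 R _ m setT setT (flat 0) _ openT (fun _ _ => I)
      (smooth_flat R 0 m) qC).
  exists (~` C); split=> //; first exact: closed_openC.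
  apply: (eq_smooth_on aB _ (f := fun=> 0)); first exact: closed_openC.
    by move=> y /hC.
  exact: smooth_on_cst.
- rewrite /h; case: asboolP => // _; apply: flat_gt0.
  rewrite /sqdist big1 ?subr0 ?exprn_gt0 // => i _.
  by rewrite subrr expr0n.
- by exists C; split=> // x /CU[].
Qed.

(** Bump functions at finitely many points have no common zero, by compactness;
    dividing by the square root of the sum [S] of their squares, which is
    positive, makes the squares sum to 1. *)
Lemma square_partition (B : manifold R) (U : B -> set B) :
  compact [set: B] -> (forall b, open (U b)) -> (forall b, U b b) ->
  exists (m : nat) (c : 'I_m -> B) (phi : 'I_m -> B -> R),
    [/\ forall l, smooth_on (matlas B) setT (phi l),
        forall l, exists C, [/\ closed C, C `<=` U (c l) &
          forall x, ~ C x -> phi l x = 0] &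
        forall x, \sum_(l < m) phi l x ^+ 2 = 1].
Proof.
move=> cB oU Ub; have aB := matlasP B.
have /choice[h hP] b := bump_function (oU b) (Ub b).
(* Finite sets of points, directed by inclusion: compactness along this filter
   yields finitely many points whose bumps have no common zero. *)
pose F : set_system (seq B) :=
  [set Q | exists s : seq B, forall t : seq B, {subset s <= t} -> Q t].
have FF : Filter F.
  split; first by exists [::].
    move=> Q Q' [s sQ] [s' sQ']; exists (s ++ s') => t st; split.
      by apply: sQ => x xs; apply: st; rewrite mem_cat xs.
    by apply: sQ' => x xs; apply: st; rewrite mem_cat xs orbT.
  by move=> Q Q' QQ' [s sQ]; exists s => t /sQ /QQ'.
have [s sP] : \forall s \near F,
    [set: B] `<=` [set x | exists2 b, b \in s & h b x != 0].
  move/compact_near_coveringP: cB; apply => x _.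
  have [hs hx _] := hP x.
  have hc := smooth_on_continuous aB hs.
  exists ([set y | h x y != 0], [set s : seq B | x \in s]).
    split => /=.
      apply: (hc x [set z | z != 0]); apply: open_nbhs_nbhs; split.
        exact: open_neq.
      by rewrite /= gt_eqF.
    by exists [:: x] => t; apply; rewrite mem_head.
  by move=> [y t] [/= hy xt]; exists x.
have {}sP x : exists2 b, b \in s & h b x != 0 by apply: (sP s).
pose S x := \sum_(b <- s) h b x ^+ 2.
have sS : smooth_on (matlas B) setT S.
  apply: (smooth_on_sum aB _ openT) => b; have [hs _ _] := hP b.
  exact: (smooth_onM aB openT hs hs).
have S0 x : 0 < S x.
  have [b bs hb] := sP x; rewrite /S (big_rem b) //=.
  by rewrite ltr_pwDl ?sumr_ge0 // ?exprn_even_gt0 // => i _; rewrite sqr_ge0.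
pose phi l x := h (tnth (in_tuple s) l) x * S x `^ (- 2^-1).
exists (size s), (tnth (in_tuple s)), phi; split.
- move=> l; have [hs _ _] := hP (tnth (in_tuple s) l).
  apply: (smooth_onM aB openT hs).
  exact: (smooth_on_comp1 aB openT (fun x _ => S0 x) (smooth_powR _) sS).
- move=> l; have [_ _ [C [cC CU hC]]] := hP (tnth (in_tuple s) l).
  by exists C; split => // x /hC hx; rewrite /phi hx mul0r.
- move=> x; rewrite /phi.
  under eq_bigr do rewrite exprMn.
  rewrite -mulr_suml -(big_tnth _ _ s xpredT (fun b => h b x ^+ 2)) -/(S x).
  rewrite powRN powR12_sqrt ?(ltW (S0 x)) // exprVn sqr_sqrtr ?(ltW (S0 x)) //.
  by rewrite divff // gt_eqF.
Qed.

End SmoothFunctions.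

(** * Matrix coefficients of corepresentations *)

Section HopfAlgebra.
Variables (R : realType) (k : nat) (G : matrix_lie_group R k).

Definition csmooth_on (M : topologicalType) n (A : set (chart R M n))
    (W : set M) (f : M -> R[i]) : Prop :=
  smooth_on A W (fun x => complex.Re (f x)) /\
  smooth_on A W (fun x => complex.Im (f x)).

Lemma complex_ReM (x y : R[i]) :
  complex.Re (x * y) =
    complex.Re x * complex.Re y - complex.Im x * complex.Im y.
Proof. by case: x y => [a b] [c d]. Qed.

Lemma complex_ImM (x y : R[i]) :
  complex.Im (x * y) =
    complex.Re x * complex.Im y + complex.Im x * complex.Re y.
Proof. by case: x y => [a b] [c d]. Qed.

Lemma csmooth_onM (M : topologicalType) n (A : set (chart R M n))
    (W : set M) (f g : M -> R[i]) : is_atlas A -> open W ->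
  csmooth_on A W f -> csmooth_on A W g -> csmooth_on A W (fun x => f x * g x).
Proof.
move=> aA oW [fr fi] [gr gi]; split.
  have rr := smooth_onM aA oW fr gr.
  have ii := smooth_onM aA oW (smooth_on_cst W (-1 : R))
    (smooth_onM aA oW fi gi).
  have C := smooth_onD aA oW rr ii.
  apply: (eq_smooth_on aA oW _ C).
  by move=> x _; rewrite complex_ReM mulN1r.
under eq_fun do rewrite complex_ImM.
exact: (smooth_onD aA oW (smooth_onM aA oW fr gi) (smooth_onM aA oW fi gr)).
Qed.

Lemma realcoord_lshift (A : 'M[R[i]]_k) i j :
  realcoord A ord0 (lshift _ (mxvec_index i j)) = complex.Re (A i j).
Proof. by rewrite /realcoord row_mxEl mxvecE mxE. Qed.

Lemma realcoord_rshift (A : 'M[R[i]]_k) i j :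
  realcoord A ord0 (rshift _ (mxvec_index i j)) = complex.Im (A i j).
Proof. by rewrite /realcoord row_mxEr mxvecE mxE. Qed.

(** The real and imaginary parts of the matrix entries are coordinates of the
    smooth inclusion of [G] in the matrices, and sums, products and conjugates
    of smooth functions are smooth. *)
Lemma hopf_alg_smooth (g : G -> R[i]) :
  hopf_alg g -> csmooth_on (matlas G) setT g.
Proof.
have aG := matlasP G.
have coordS l : smooth_on (matlas G) setT
    (fun A => mxset_coord (A : mxset_space (mlg_set G)) ord0 l).
  apply/smooth_onT => c Ac m.
  have [[_ oi] _ _ _] := atlas_chart aG Ac.
  exact: (Ck_coord l oi (mlg_incl_smooth Ac m)).
elim => {g} [i j|a|g h _ [gr gi] _ [hr hi]|g h _ gs _ hs|g _ [gr gi]].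
- split; apply: (eq_smooth_on aG openT _ (coordS _)) => A _.
    exact: realcoord_lshift.
  exact: realcoord_rshift.
- by split; apply: smooth_on_cst.
- split.
    apply: (eq_smooth_on aG openT _ (smooth_onD aG openT gr hr)) => A _.
    by case: (g A) (h A) => [? ?] [? ?].
  apply: (eq_smooth_on aG openT _ (smooth_onD aG openT gi hi)) => A _.
  by case: (g A) (h A) => [? ?] [? ?].
- exact: (csmooth_onM aG openT gs hs).
- split.
    by apply: (eq_smooth_on aG openT _ gr) => A _; case: (g A).
  apply: (eq_smooth_on aG openT _
    (smooth_onM aG openT (smooth_on_cst _ (-1 : R)) gi)) => A _.
  by rewrite mulN1r; case: (g A).
Qed.

Lemma hopf_alg_sum m (h : 'I_m -> G -> R[i]) :
  (forall l, hopf_alg (h l)) -> hopf_alg (fun A => \sum_(l < m) h l A).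
Proof.
move=> hh; elim: (index_enum _) => [|l r IH].
  by under eq_fun do rewrite big_nil; apply: hopf_cst.
by under eq_fun do rewrite big_cons; apply: hopf_add.
Qed.

(** In an orthonormal basis these are the coefficients [g_ij] of the
    corepresentation. *)
Lemma corep_coef_hopf (V : corep G) (v w : V) :
  hopf_alg (fun A => cdot V (cdelta v A) w).
Proof.
have [m [u [h [hh ->]]]] := cdelta_tensorH v.
under eq_fun do rewrite linear_sumlz /=.
apply: hopf_alg_sum => l.
under eq_fun do rewrite linearZl /=.
by apply: hopf_mul => //; apply: hopf_cst.
Qed.

End HopfAlgebra.

Lemma orthonormal_parseval (R : realType) (V : vectType R[i])
    (d : {dot V for @Num.conj R[i]}) n (e : n.-tuple V) (u w : V) :
  basis_of fullv e -> orthonormal d e ->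
  \sum_(r < n) Num.conj (d u (tnth e r)) * d w (tnth e r) = d w u.
Proof.
move=> be /orthonormalP[ue oe].
have de i j : d (tnth e i) (tnth e j) = (i == j)%:R.
  by rewrite oe ?mem_tnth // (inj_eq (tuple_uniqP _ ue)).
have wE : w = \sum_(r < n) d w (tnth e r) *: tnth e r.
  rewrite {1}(coord_basis be (memvf w)); apply: eq_bigr => r _.
  rewrite -tnth_nth; congr (_ *: _).
  rewrite {2}(coord_basis be (memvf w)) linear_sumlz /= (bigD1 r) //=.
  rewrite big1 ?addr0 => [|s sr]; rewrite -tnth_nth linearZl /= de.
    by rewrite eqxx mulr1.
  by rewrite (negbTE sr) mulr0.
rewrite [in RHS]wE linear_sumlz /=; apply: eq_bigr => r _.
by rewrite linearZl /= mulrC [d (tnth e r) u]hermC expr0 mul1r.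
Qed.

(** * Intertwiners from local trivializations *)

Theorem proposition4p1 (R : realType) (k : nat) (G : matrix_lie_group R k)
    (P B : manifold R) (proj : P -> B) (act : P -> G -> P) :
  compact [set: G] ->
  principal_bundle proj act ->
  compact [set: B] ->
  forall T : corep G -> Prop, complete_irreducibles T ->
  forall V : corep G, T V ->
  forall (n : nat) (e : n.-tuple V),
    basis_of fullv e -> orthonormal (cdot V) e ->
  exists (d : nat) (Tk : 'I_d -> V -> P -> R[i]),
    (forall l, Mor act V (Tk l)) /\
    let x (l : 'I_d) (i : 'I_n) : P -> R[i] := Tk l (tnth e i) in
    forall i j : 'I_n,
      (fun p : P => \sum_(l < d) Num.conj (x l i p) * x l j p) =
      (fun=> (i == j)%:R).
Proof.
move=> _ pb cB T _ V _ n e be oe.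
have aP := matlasP P; have aB := matlasP B; have aG := matlasP G.
have /choice[U UP] := pb_loc_triv pb.
have /choice[tau tauP] b : exists t : P -> G,
    exists s, local_trivialization proj act (U b) t s.
  by have [_ _ [t [s ts]]] := UP b; exists t, s.
have oU b : open (U b) by have [] := UP b.
have Ub b : U b b by have [] := UP b.
have [m [c [phi [sphi phiC phi1]]]] := square_partition cB oU Ub.
have projc : continuous proj.
  by move=> x; apply: (pb_proj_smooth pb).1.
have oW b : open (proj @^-1` U b) by apply: open_comp => // x _; apply: projc.
have sproj := pb_proj_smooth pb.
(* In the trivialization [l], the group coordinate [tau] makes the [r]-th row of
   the unitary matrix of coefficients equivariant; [phi l] globalizes it. *)
pose coef l (r : 'I_n) v (x : P) : R[i] :=
  cdot V (cdelta v (tau (c l) x)) (tnth e r).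
pose Tq (q : 'I_m * 'I_n) v x : R[i] :=
  real_complex R (phi q.1 (proj x)) * coef q.1 q.2 v x.
have TqM q : Mor act V (Tq q).
  case: q => l r; split => [a u v x|v|v].
  - by rewrite /Tq /coef cdelta_linear linearDl linearZl /= mulrDr mulrCA.
  - have [sr si] := hopf_alg_smooth (corep_coef_hopf v (tnth e r)).
    have [s [stau _ _ _ _]] := tauP (c l).
    have [C [cC CU C0]] := phiC l.
    have cut (g : G -> R) : smooth_on (matlas G) setT g ->
        smooth_on (matlas P) setT (fun x => phi l (proj x) * g (tau (c l) x)).
      move=> sg; apply: (smooth_on_cutoff aP (oW (c l))
        (C := proj @^-1` C) (f := phi l \o proj) (g := g \o tau (c l))).
      + by apply: preimage_closed => // x _; apply: projc.
      + by move=> x; apply: CU.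
      + by move=> x; apply: C0.
      + exact: (smooth_on_pullback aP aB openT sproj (sphi l)).
      + exact: (smooth_on_pullback aP aG (oW _) stau sg).
    split; apply/smooth_onT; rewrite /Tq /=.
      apply: (eq_smooth_on aP openT _ (cut _ sr)) => x _ /=.
      by rewrite complex_ReM /= mul0r subr0.
    apply: (eq_smooth_on aP openT _ (cut _ si)) => x _ /=.
    by rewrite complex_ImM /= mul0r addr0.
  - apply/funext => -[x A].
    rewrite /coaction /tensor_map_id /Tq /coef /= (pb_proj_act pb).
    (* Off the trivializing set both sides vanish, since [phi l] does. *)
    have [Ux|nUx] := pselect (U (c l) (proj x)); last first.
      have [C [_ CU C0]] := phiC l.
      by rewrite C0 ?mul0r // => /CU.
    have [s [_ _ _ _ tauM]] := tauP (c l).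
    rewrite tauM //; congr (_ * cdot V _ _).
    exact: (congr1 (fun F => F (tau (c l) x, A)) (cdelta_coassoc v)).
exists #|{: 'I_m * 'I_n}|, (fun l => Tq (enum_val l)); split => // x i j.
apply/funext => p; rewrite /x.
rewrite -(reindex (enum_val (A := {: 'I_m * 'I_n})) (P := xpredT)
  (F := fun q => Num.conj (Tq q (tnth e i) p) * Tq q (tnth e j) p)) /=;
  last first.
  exact/onW_bij/enum_val_bij.
rewrite -(pair_bigA _ (fun l r =>
  Num.conj (Tq (l, r) (tnth e i) p) * Tq (l, r) (tnth e j) p)) /=.
(* The columns of the unitary matrix of coefficients are orthonormal. *)
have tE (l : 'I_m) :
    \sum_(r < n) Num.conj (Tq (l, r) (tnth e i) p) * Tq (l, r) (tnth e j) p =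
    real_complex R (phi l (proj p) ^+ 2) * (i == j)%:R.
  transitivity (real_complex R (phi l (proj p) ^+ 2) * \sum_(r < n)
      Num.conj (coef l r (tnth e i) p) * coef l r (tnth e j) p).
    rewrite mulr_sumr; apply: eq_bigr => r _; rewrite /Tq /= rmorphM /=.
    have -> : Num.conj (real_complex R (phi l (proj p))) =
        real_complex R (phi l (proj p)).
      by apply/CrealP; rewrite complex_real.
    by rewrite rmorphXn /=; ring.
  rewrite orthonormal_parseval // cdelta_unitary.
  have /orthonormalP[ue oe'] := oe.
  by rewrite oe' ?mem_tnth // (inj_eq (tuple_uniqP _ ue)) eq_sym.
under eq_bigr do rewrite tE.
rewrite -mulr_suml -rmorph_sum /= phi1.
by rewrite mul1r.
Qed.
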